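(* For all positive integers $d,k$, all real numbers $c,\delta>0$, and every real $\varepsilon$ with $0<\varepsilon\leq 1/3$, there exists a positive number $Z_0=Z_0(d,k,c,\delta,\varepsilon)$ with the following property: if $S$ is a $\delta$-separated point set in the $d$-dimensional cube $[0,L]^d$, with at least $cL^d$ points, where $L\geq Z_0$, then $S$ contains a subset that forms an $\varepsilon$-approximate $k$-grid in $\mathbb{R}^d$. Moreover, one can set $$ Z_0(d,k,c,\delta,\varepsilon)=2\delta\cdot (ks)^j, \quad\text{where}\quad s=\left\lceil \frac{\sqrt{d}}{\varepsilon} \right\rceil, \qquad r=\frac{k^d}{k^d-1}, \qquad j=\left\lceil \frac{\log \frac{\kappa_d}{c\,\delta^d}}{\log r} \right\rceil. $$ Here $\kappa_d$ is a constant depending on $d$: $$ \kappa_d=\left\lceil \frac{3^d\cdot (d/2)!}{\pi^{d/2}} \right\rceil \text{ if } d \text{ is even}, \qquad \kappa_d=\left\lceil \frac{3^d\cdot (1\cdot 3\cdots d)}{2\cdot (2\pi)^{(d-1)/2}} \right\rceil \text{ if } d \text{ is odd}. $$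
   Context: Let $\delta>0$. A point set $S\subset\mathbb{R}^d$ is $\delta$-separated if the minimum pairwise Euclidean distance among points of $S$ is at least $\delta$. A set $Q'$ is homothetic to a finite pattern $P\subset\mathbb{R}^d$ if $Q'=\lambda P+v$ for some $\lambda>0$ and $v\in\mathbb{R}^d$ (scaling and translation, no rotation). For $0<\varepsilon\leq 1/3$ and finite point sets $P,Q$ in $\mathbb{R}^d$ with $|P|=|Q|=n$, $Q$ is an $\varepsilon$-approximate homothetic copy of $P$ if there exist a set $Q'=\{q'_1,\ldots,q'_n\}$ homothetic to $P$ and a labeling $Q=\{q_1,\ldots,q_n\}$ by distinct points such that, for each $i$, $q_i$ lies in the closed ball of radius $\varepsilon m$ centered at $q'_i$, where $m$ is the minimum pairwise distance among points of $Q'$. A $k$-grid in $\mathbb{R}^d$ is a homothetic copy of $\{1,2,\ldots,k\}^d$; an $\varepsilon$-approximate $k$-grid is an $\varepsilon$-approximate homothetic copy of $\{1,2,\ldots,k\}^d$. The expression $1\cdot 3\cdots d$ denotes the product of all odd integers from $1$ to $d$.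
   Formalization: The exponent j is replaced by max(0, j), since for j < 0 the stated Z_0 is too small (d=1, k=2, δ=1, ε=1/3, c=2^11, S a single point); for k = 1, where r = 1/0 is undefined, j is taken to be 0. *)

(* Defs.v *)
(* MathComp / MathComp-Analysis *)
From HB Require Import structures.
From mathcomp Require Import all_boot all_order all_algebra finmap.
From mathcomp Require Import all_classical all_reals all_analysis.
Set Implicit Arguments.
Unset Strict Implicit.
Unset Printing Implicit Defensive.
Import Order.TTheory GRing.Theory Num.Theory.
Local Open Scope fset_scope.
Local Open Scope classical_set_scope.
Local Open Scope ring_scope.

Section Configurations.
Variables (R : realType) (d : nat).
Implicit Types (x y v : 'rV[R]_d) (S : set 'rV[R]_d) (P Q : {fset 'rV[R]_d}).

(* The library norm on 'rV[R]_d is the max norm, hence this definition. *)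
Definition eucl_dist x y : R := Num.sqrt (\sum_(i < d) (x 0 i - y 0 i) ^+ 2).

(* Extended-real valued: +oo when S has at most one point, so that such sets
   are delta-separated for every delta. *)
Definition min_dist S : \bar R :=
  ereal_inf [set e | exists x y, [/\ S x, S y, x <> y & e = (eucl_dist x y)%:E]].

Definition delta_separated (delta : R) S : Prop := (delta%:E <= min_dist S)%E.

Definition cube (L : R) : set 'rV[R]_d := [set x | forall i, 0 <= x 0 i <= L].

(* S is not assumed finite. *)
Definition has_at_least S (a : R) : Prop :=
  exists2 A : {fset 'rV[R]_d}, [set` A] `<=` S & a <= #|` A|%:R.

Definition homothetic Q' P : Prop :=
  exists (lam : R) v, 0 < lam /\ Q' = [fset lam *: p + v | p in P].

Definition approx_homothetic_copy (eps : R) P Q : Prop :=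
  exists Q' (q q' : 'I_#|` P| -> 'rV[R]_d),
    [/\ homothetic Q' P,
        Q' = [fset q' i | i in 'I_#|` P|],
        injective q,
        Q = [fset q i | i in 'I_#|` P|] &
        forall i, ((eucl_dist (q i) (q' i))%:E <= eps%:E * min_dist [set` Q'])%E].

Definition std_grid (k : nat) : {fset 'rV[R]_d} :=
  [fset (\row_(i < d) ((f : {ffun 'I_d -> 'I_k}) i).+1%:R : 'rV[R]_d)
     | f in {ffun 'I_d -> 'I_k}].

Definition approx_grid (eps : R) (k : nat) Q : Prop :=
  approx_homothetic_copy eps (std_grid k) Q.

End Configurations.

Definition grid_threshold (R : realType) (d k : nat) (c delta eps Z0 : R) : Prop :=
  forall (L : R) (S : set 'rV[R]_d),
    Z0 <= L -> delta_separated delta S -> S `<=` cube L ->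
    has_at_least S (c * L ^+ d) ->
    exists2 Q : {fset 'rV[R]_d}, [set` Q] `<=` S & approx_grid eps k Q.

Section Threshold.
Variable R : realType.

(* In both cases the exponent of pi or 2 * pi is d./2, the floor of d / 2. *)
Definition kappa (d : nat) : int :=
  if odd d then
    Num.ceil (3 ^+ d * (\prod_(1 <= i < d.+1 | odd i) i)%N%:R
              / (2 * (2 * pi) ^+ d./2) : R)
  else Num.ceil (3 ^+ d * (d./2)`!%:R / pi ^+ d./2 : R).

Definition grid_s (d : nat) (eps : R) : int := Num.ceil (Num.sqrt d%:R / eps).

(* For k = 1 the denominator vanishes; since x / 0 = 0 and ln 0 = 0, grid_j is
   then 0, in agreement with the convention r = +oo. *)
Definition grid_r (d k : nat) : R := (k ^ d)%:R / ((k ^ d)%:R - 1).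

Definition grid_j (d k : nat) (c delta : R) : int :=
  Num.ceil (ln ((kappa d)%:~R / (c * delta ^+ d)) / ln (grid_r d k)).

(* grid_j counts subdivision steps, so it is truncated at 0. It is negative only
   if c * delta ^+ d > kappa d, and the bound 2 * delta * (k * s) ^ j would then
   be too small: S may be a single point, for L small. *)
Definition Z0_explicit (d k : nat) (c delta eps : R) : R :=
  2 * delta * (k%:R * (grid_s d eps)%:~R) ^ Num.max 0 (grid_j d k c delta).

End Threshold.

(* Main.v *)
Require Import Defs.
From HB Require Import structures.
From mathcomp Require Import all_boot all_order all_algebra finmap.
From mathcomp Require Import all_classical all_reals all_analysis.
From mathcomp Require Import zify ring lra.
Import Order.TTheory GRing.Theory Num.Theory.
Import numFieldNormedType.Exports.
Set Implicit Arguments.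
Unset Strict Implicit.
Unset Printing Implicit Defensive.
Local Open Scope ring_scope.

(* Density increment.  Cut a cube into (k s)^d cells and index each cell by its
   position b in {0..s-1}^d inside one of the k^d blocks.  If for some b all the
   k^d cells with position b meet the set, picking one point in each gives an
   approximate k-grid.  Otherwise every b has an empty cell, at most
   (k^d - 1) s^d cells are occupied, and some cell has density at least
   r = k^d / (k^d - 1) times the original one.  After j steps the density would
   contradict a packing bound: disjoint balls of radius delta / 2 centred in a
   cube of side l >= 2 delta lie in a cube of side l + delta <= 3 l / 2, so the
   density is at most (3^d / vol B^d) / delta^d <= kappa_d / delta^d.  As j may
   make r^j equal to kappa_d / (c delta^d), a strict packing bound is needed; it
   holds because the balls miss the corners of the larger cube.

   Volumes of balls are obtained by counting lattice points.  The number of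
   w in Z^d with |w|^2 <= m is the partial sum up to m of the coefficients of
   theta ^+ d, where theta = sum_b 'X^(b^2), so that the recursion
   vol B^(d+2) = 2 pi / (d + 2) vol B^d comes from theta ^+ (d + 2) =
   theta ^+ d * theta ^+ 2 by summation by parts.  The packing bound follows by
   rounding the points to a lattice whose mesh tends to 0. *)

(** One of the two truncated differences is 0, so this is the square of [a - b] kept inside
    [nat]. *)
Definition sqdist (a b : nat) := (((a - b) + (b - a)) ^ 2)%N.

Lemma natr_sqdist (K : comNzRingType) (a b : nat) :
  (sqdist a b)%:R = (a%:R - b%:R) ^+ 2 :> K.
Proof.
rewrite /sqdist; case: (leqP a b) => [leab|/ltnW leba].
  rewrite (_ : a - b = 0)%N; last by apply/eqP; rewrite subn_eq0.
  by rewrite add0n natrX natrB // -sqrrN opprB.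
rewrite (_ : b - a = 0)%N; last by apply/eqP; rewrite subn_eq0.
by rewrite addn0 natrX natrB.
Qed.

(** * Partial sums of coefficients and the truncated theta series *)

Section PartialSums.
Variable R : realType.
Implicit Types p q : {poly R}.

Definition psum p m : R := \sum_(j < m.+1) p`_j.

Lemma psumM p q m : psum (p * q) m = \sum_(j < m.+1) p`_j * psum q (m - j).
Proof.
rewrite /psum; elim: m => [|m IHm]; first by rewrite !big_ord1 coefM big_ord1.
rewrite big_ord_recr /= IHm coefM [in RHS]big_ord_recr /= subnn big_ord1.
rewrite [X in _ + X]big_ord_recr /= subnn addrA -big_split /=; congr (_ + _).
apply: eq_bigr => -[j /= lejm] _.
by rewrite subSn // [in RHS]big_ord_recr /= mulrDr.
Qed.

Lemma sum_psum p m :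
  \sum_(j < m.+1) psum p j = \sum_(j < m.+1) p`_j * (m - j).+1%:R.
Proof.
elim: m => [|m IHm]; first by rewrite !big_ord1 /psum big_ord1 mulr1.
rewrite big_ord_recr /= IHm [RHS]big_ord_recr /= subnn mulr1 /psum.
rewrite [X in _ + X]big_ord_recr /= addrA -big_split /=; congr (_ + _).
apply: eq_bigr => -[j /= lejm] _.
by rewrite subSn // [in RHS]mulrS mulrDr mulr1 addrC.
Qed.

(** The theta series cut off at [|b| <= t], with the summation index shifted by [t] to stay in
    [nat]. The cut does not affect the coefficients of degree at most [t ^ 2]. *)
Definition theta t : {poly R} := \sum_(b < (t + t).+1) 'X^(sqdist b t).

Lemma thetaE t : theta t = 1 + \sum_(b < t) 'X^(b.+1 ^ 2)%N *+ 2.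
Proof.
rewrite /theta -addSn big_split_ord /= big_ord_recr /= addrAC addrC.
congr (_ + _); first by rewrite /sqdist !subnn expr0.
rewrite (reindex_inj rev_ord_inj) /= -big_split /=; apply: eq_bigr => -[b ltbt] _ /=.
by rewrite mulr2n; congr ('X^_ + 'X^_); congr (_ ^ 2)%N; lia.
Qed.

Lemma theta_ge0 t j : 0 <= (theta t)`_j.
Proof. by rewrite coef_sum sumr_ge0 // => b _; rewrite coefXn ler0n. Qed.

Lemma thetaX_ge0 t n j : 0 <= (theta t ^+ n)`_j.
Proof.
elim: n j => [|n IHn] j; first by rewrite expr0 coef1 ler0n.
by rewrite exprS coefM sumr_ge0 // => i _; rewrite mulr_ge0 ?theta_ge0.
Qed.

Lemma sum_coefXn (h : nat -> R) e m :
  \sum_(j < m.+1) ('X^e : {poly R})`_j * h j = (e <= m)%N%:R * h e.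
Proof.
under eq_bigr do rewrite coefXn.
have [leem|ltme] := leqP e m.
  have ltem : (e < m.+1)%N by [].
  rewrite (bigD1 (Ordinal ltem)) //= eqxx big1 ?addr0 // => j /negPf.
  by rewrite -val_eqE /= => ->; rewrite mul0r.
rewrite big1 ?mul0r // => -[j /= ltjm] _; rewrite ltn_eqF ?mul0r //.
exact: leq_ltn_trans (_ : j <= m)%N ltme.
Qed.

(** With [r] the integer square root of [m], exactly the exponents [b ^ 2] with [|b| <= r] survive;
    0 occurs once and the others twice. *)
Lemma sum_theta (h : nat -> R) t m r :
    (r <= t)%N -> (r ^ 2 <= m)%N -> (m < r.+1 ^ 2)%N ->
  \sum_(j < m.+1) (theta t)`_j * h j = h 0%N + 2 * \sum_(b < r) h (b.+1 ^ 2)%N.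
Proof.
move=> lert ler ltr; rewrite thetaE.
under eq_bigr => j _ do rewrite coefD mulrDl -(expr0 'X) coef_sum mulr_suml.
rewrite big_split /= sum_coefXn mul1r exchange_big /=; congr (_ + _).
rewrite (big_ord_widen_cond t xpredT (fun b => h (b.+1 ^ 2)%N) lert) /=.
rewrite mulr_sumr [RHS]big_mkcond /=; apply: eq_bigr => b _.
under eq_bigr => j _ do rewrite coefMn mulrnAl.
rewrite sumrMnl sum_coefXn.
case: (ltnP b r) => [ltbr|lerb].
  have -> : (b.+1 ^ 2 <= m)%N by apply: leq_trans ler; rewrite leq_sqr.
  by rewrite /= mul1r mulr_natl.
have -> : (b.+1 ^ 2 <= m)%N = false.
  by apply/negbTE; rewrite -ltnNge; apply: leq_trans ltr _; rewrite leq_sqr.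
by rewrite mul0r mul0rn.
Qed.

Lemma psumE p m : psum p m = \sum_(j < m.+1) p`_j * 1.
Proof. by apply: eq_bigr => j _; rewrite mulr1. Qed.

(** Expanding the power chooses one exponent per coordinate, so each lattice point contributes a
    monomial whose degree is its squared distance to the centre [(t, ..., t)]. *)
Lemma card_lattice_ball d t m :
  #|[set w : {ffun 'I_d -> 'I_(t + t).+1} | (\sum_i sqdist (w i) t <= m)%N]|%:R
    = psum (theta t ^+ d) m.
Proof.
rewrite -[in RHS](card_ord d) -prodr_const bigA_distr_bigA /=.
rewrite psumE; under [RHS]eq_bigr => j _ do rewrite coef_sum mulr_suml.
rewrite exchange_big /= -sum1_card natr_sum big_mkcond /=.
apply: eq_bigr => w _; rewrite inE.
rewrite (prodrXr 'X).
rewrite (sum_coefXn (fun=> 1)) mulr1; case: ifP => //.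
Qed.

End PartialSums.

(** * The area of a quarter disk *)

Section Disk.
Variable R : realType.

(** The right side minus the left side is [f b - f a], and the derivative [df] is nonnegative on
    [[a, b]] because the cosine decreases there. *)
Lemma sector_le (a b : R) : 0 <= a -> a <= b -> b <= pi / 2 ->
  (sin b * cos b + b) - (sin a * cos a + a) <= 2 * cos a * (sin b - sin a).
Proof.
move=> a0 ab bpi.
pose f x : R := 2 * cos a * sin x - sin x * cos x - x.
pose df x : R := 2 * cos x * (cos a - cos x).
have fdf (x : R) : is_derive x (1 : R) f (df x).
  apply: is_derive_eq; rewrite /df /GRing.scale /=.
  have := cos2Dsin2 x; rewrite !expr2; lra.
have [c] : exists2 c, c \in `[a, b] & f b - f a = df c * (b - a).
  apply: MVT_segment => //.
  by apply: derivable_within_continuous => x _; apply: ex_derive.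
rewrite in_itv /= => /andP[ac cb] fE.
have : 0 <= f b - f a.
  rewrite fE !mulr_ge0 ?subr_ge0 //.
    by apply: cos_ge0_pihalf; have := pi_gt0 R; lra.
  by rewrite leNgt ltr_cos ?in_itv /= -?leNgt //; have := pi_gt0 R; lra.
by rewrite /f; lra.
Qed.

Lemma asin_ge0 (x : R) : 0 <= x <= 1 -> 0 <= asin x.
Proof.
move=> /andP[x0 x1].
have xI : -1 <= x <= 1 by lra.
rewrite leNgt; apply/negP => ltx0.
have : sin (asin x) < sin 0.
  have := pi_gt0 R; have := asin_geNpi2 xI; have := asin_lepi2 xI => *.
  by rewrite ltr_sin ?in_itv /=; lra.
by rewrite asinK ?in_itv //= sin0; lra.
Qed.

Lemma asin_le (x y : R) : 0 <= x -> x <= y -> y <= 1 -> asin x <= asin y.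
Proof.
move=> x0 xy y1.
have xI : -1 <= x <= 1 by lra.
have yI : -1 <= y <= 1 by lra.
rewrite leNgt; apply/negP => ltx0.
have : sin (asin y) < sin (asin x).
  have := pi_gt0 R; have := asin_geNpi2 xI; have := asin_lepi2 xI.
  have := asin_geNpi2 yI; have := asin_lepi2 yI => *.
  by rewrite ltr_sin ?in_itv /=; lra.
by rewrite !asinK ?in_itv //=; lra.
Qed.

Lemma asin0 : asin 0 = 0 :> R.
Proof. by rewrite -[in LHS]sin0 sinK // in_itv /=; have := pi_gt0 R; lra. Qed.

Lemma asin1 : asin 1 = pi / 2 :> R.
Proof.
by rewrite -[in LHS]sin_pihalf sinK // in_itv /=; have := pi_gt0 R; lra.
Qed.

Definition area (x : R) := (x * Num.sqrt (1 - x ^+ 2) + asin x) / 2.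

(** This is [sector_le] at the angles [asin x] and [asin y]. *)
Lemma area_le (x y : R) : 0 <= x -> x <= y -> y <= 1 ->
  area y - area x <= Num.sqrt (1 - x ^+ 2) * (y - x).
Proof.
move=> x0 xy y1.
have xI : -1 <= x <= 1 by lra.
have yI : -1 <= y <= 1 by lra.
have := sector_le (asin_ge0 _) (asin_le x0 xy y1) (asin_lepi2 yI).
rewrite !asinK ?in_itv //= !cos_asin // /area x0 (le_trans xy y1) => /(_ isT).
lra.
Qed.

(* A left Riemann sum of a decreasing function dominates its integral; [area] is
   a primitive of [Num.sqrt (1 - x ^+ 2)]. *)
Lemma quarter_disk_le (r : R) q : q%:R <= r -> r < q.+1%:R ->
  pi / 4 * r ^+ 2 <= \sum_(b < q.+1) Num.sqrt (r ^+ 2 - b%:R ^+ 2).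
Proof.
move=> qr rq; have [->|r_neq0] := eqVneq r 0.
  by rewrite expr0n mulr0 sumr_ge0 // => b _; rewrite sqrtr_ge0.
have r0 : 0 < r by have := ler0n R q; lra.
have step x y : 0 <= x -> x <= y -> y <= r -> y - x <= 1 ->
    r ^+ 2 * area (y / r) - r ^+ 2 * area (x / r) <= Num.sqrt (r ^+ 2 - x ^+ 2).
  move=> x0 xy yr yx1.
  have -> : r ^+ 2 - x ^+ 2 = r ^+ 2 * (1 - (x / r) ^+ 2) by field.
  rewrite sqrtrM ?sqr_ge0 // sqrtr_sqr gtr0_norm //.
  have := @area_le (x / r) (y / r) (divr_ge0 x0 (ltW r0)).
  rewrite ler_pM2r ?invr_gt0 // ler_pdivrMr // mul1r => /(_ xy yr).
  rewrite -(ler_pM2l (exprn_gt0 2 r0)) mulrBr => /le_trans; apply.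
  set s := Num.sqrt _; have s0 : 0 <= s by exact: sqrtr_ge0.
  have -> : r ^+ 2 * (s * (y / r - x / r)) = r * s * (y - x) by field.
  by rewrite -[leRHS]mulr1 ler_wpM2l // mulr_ge0 // ltW.
have part n : (n <= q)%N ->
    r ^+ 2 * area (n%:R / r) <= \sum_(b < n) Num.sqrt (r ^+ 2 - b%:R ^+ 2).
  elim: n => [|n IHn] nq; first by rewrite big_ord0 mul0r /area mul0r asin0 addr0 mul0r mulr0.
  rewrite big_ord_recr /=; have := IHn (ltnW nq).
  have := @step n%:R n.+1%:R (ler0n _ _).
  rewrite ler_nat leqnSn => /(_ isT).
  have -> : n.+1%:R - n%:R = 1 :> R by rewrite -natr1; ring.
  move=> /(_ _ (lexx _)) h1 h2; have : n.+1%:R <= r.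
    by apply: le_trans qr; rewrite ler_nat.
  by move=> /h1; lra.
(* The last interval [[q, r]] may be shorter than 1, which [step] allows. *)
rewrite big_ord_recr /=; have := part q (leqnn q).
have := @step q%:R r (ler0n _ _) qr (lexx _); rewrite divff //.
have -> : area 1 = pi / 4 by rewrite /area expr1n subrr sqrtr0 mulr0 asin1; lra.
have : r - q%:R <= 1 by move: rq; rewrite -natr1; lra.
by move=> h /(_ h); lra.
Qed.

End Disk.

(** * Counting lattice points in balls *)

Section BallVolume.
Variable R : realType.
Local Notation rt m := (Num.sqrt m%:R : R).

Lemma nat_sqrt (m : nat) :
  exists r : nat, [/\ (r ^ 2 <= m)%N, (m < r.+1 ^ 2)%N & r%:R <= rt m < r.+1%:R].
Proof.
have /andP[le_r lt_r] := truncn_itv (sqrtr_ge0 (m%:R : R)).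
exists (Num.truncn (rt m)); rewrite le_r lt_r; split=> //.
  rewrite -(ler_nat R) natrX -[leRHS]sqr_sqrtr //.
  by rewrite ler_pXn2r ?nnegrE ?sqrtr_ge0.
rewrite -(ltr_nat R) natrX -[ltLHS]sqr_sqrtr //.
by rewrite ltr_pXn2r ?nnegrE ?sqrtr_ge0.
Qed.

Lemma psum_theta t m r : (m <= t ^ 2)%N -> (r ^ 2 <= m)%N -> (m < r.+1 ^ 2)%N ->
  psum (theta R t) m = 1 + 2 * r%:R.
Proof.
move=> mt rm mr; rewrite psumE (sum_theta (fun=> 1)  (t := t) (r := r)) //.
  by rewrite sumr_const card_ord.
by rewrite -leq_sqr (leq_trans rm).
Qed.

Lemma psum_theta_bounds t m : (m <= t ^ 2)%N ->
  2 * rt m - 1 <= psum (theta R t) m <= 2 * rt m + 1.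
Proof.
move=> mt; have [r [rm mr]] := nat_sqrt m; rewrite (psum_theta mt rm mr) -natr1.
by lra.
Qed.

(** The disk is sliced into columns: the one at abscissa [b] has at least [2 * sqrt (m - b ^ 2) - 1]
    points. The sum over [b] is four times the Riemann sum of [quarter_disk_le], up to terms of
    order [rt m]. *)
Lemma psum_theta2_ge t m : (m <= t ^ 2)%N ->
  pi * m%:R - 4 * rt m - 2 <= psum (theta R t ^+ 2) m.
Proof.
move=> mt; have [r [rm mr /andP[rle ltr]]] := nat_sqrt m.
have rt2 : rt m ^+ 2 = m%:R by rewrite sqr_sqrtr.
have := quarter_disk_le rle ltr; rewrite rt2 big_ord_recl expr0n subr0 /= => hq.
have : \sum_(j < m.+1) (theta R t)`_j * (2 * rt (m - j) - 1)
     <= psum (theta R t ^+ 2) m.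
  rewrite expr2 psumM ler_sum // => j _; rewrite ler_wpM2l ?theta_ge0 //.
  by have /andP[] := psum_theta_bounds (leq_trans (leq_subr j m) mt).
apply: le_trans; rewrite (sum_theta (fun j => 2 * rt (m - j) - 1) (t := t) (r := r)) //; last first.
  by rewrite -leq_sqr (leq_trans rm).
rewrite subn0 big_split /= sumr_const card_ord -mulr_sumr.
rewrite [X in _ <= _ + 2 * (2 * X + _)](_ : _ =
    \sum_(b < r) Num.sqrt (m%:R - (lift ord0 b)%:R ^+ 2)); last first.
  apply: eq_bigr => b _; rewrite natrB ?natrX //.
  by apply: leq_trans rm; rewrite leq_sqr.
rewrite -[(-1) *+ r]mulr_natr.
set S := \sum_(i < r) _ in hq *; lra.
Qed.

(** A lattice ball lies in the lattice cube of the same radius. *)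
Lemma psumXM_le t n m :
  psum (theta R t ^+ n) m <= psum (theta R t) m ^+ n.
Proof.
have psum_ge0 (p : {poly R}) k : (forall j, 0 <= p`_j) -> 0 <= psum p k.
  by move=> p0; apply: sumr_ge0.
elim: n => [|n IHn].
  rewrite !expr0 psumE -(expr0 'X) (sum_coefXn (fun=> 1)) /= mul1r //.
rewrite [theta R t ^+ _]exprS psumM [leRHS]exprS /psum mulr_suml ler_sum // => j _.
rewrite ler_wpM2l ?theta_ge0 //; apply: le_trans IHn.
rewrite /psum (big_ord_widen m.+1 (fun i => (theta R t ^+ n)`_i)); last first.
  by rewrite ltnS leq_subr.
rewrite [leRHS](bigID (fun i : 'I__ => (i < (m - j).+1)%N)) /= lerDl sumr_ge0 //.
by move=> i _; exact: thetaX_ge0.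
Qed.

Lemma rt_succ_ge1 m : 1 <= rt m.+1.
Proof. by rewrite -[leLHS]sqrtr1 ler_wsqrtr // ler1n. Qed.

Lemma le_rt m n : (m <= n)%N -> rt m <= rt n.
Proof. by move=> mn; rewrite ler_wsqrtr // ler_nat. Qed.

Lemma psumXM_le_rt t n m : (m <= t ^ 2)%N ->
  psum (theta R t ^+ n) m <= (3 * rt m.+1) ^+ n.
Proof.
move=> mt; apply: le_trans (psumXM_le t n m) _.
have /andP[h1 h2] := psum_theta_bounds mt.
have h3 := rt_succ_ge1 m; have h4 := le_rt (leqnSn m).
rewrite lerXn2r ?nnegrE //.
- by apply: sumr_ge0 => j _; exact: theta_ge0.
- by lra.
Qed.

(** In the variable [u = x ^+ 2], the increment of the convex function [u^(1 + d/2)] over a unit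
    step is at most its derivative at the right end. The recursion on exponents goes by two, hence
    the pair of statements in the induction. *)
Lemma exprB_le (d : nat) (x y : R) : 0 <= y -> y <= x -> x ^+ 2 - y ^+ 2 = 1 ->
  2 * (x ^+ d.+2 - y ^+ d.+2) <= d.+2%:R * x ^+ d.
Proof.
move=> y0 yx xy1; have x0 := le_trans y0 yx.
suff H n : 2 * (x ^+ n.+2 - y ^+ n.+2) <= n.+2%:R * x ^+ n /\
           2 * (x ^+ n.+3 - y ^+ n.+3) <= n.+3%:R * x ^+ n.+1 by have [] := H d.
elim: n => [|n [IH1 IH2]].
  rewrite xy1 expr0; split; first by lra.
  have : 0 <= (x - y) ^+ 2 * (x + 2 * y) by rewrite mulr_ge0 ?sqr_ge0 //; lra.
  have -> : (x - y) ^+ 2 * (x + 2 * y) =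
    3 * x * (x ^+ 2 - y ^+ 2) - 2 * (x ^+ 3 - y ^+ 3) by ring.
  by rewrite xy1 mulr1 subr_ge0 expr1.
split=> //.
have -> : x ^+ n.+4 - y ^+ n.+4 =
    x ^+ 2 * (x ^+ n.+2 - y ^+ n.+2) + y ^+ n.+2 * (x ^+ 2 - y ^+ 2).
  by rewrite -[n.+4]/(2 + n.+2)%N !exprD; ring.
rewrite xy1 mulr1 mulrDr.
have : y ^+ n.+2 <= x ^+ n.+2 by rewrite lerXn2r.
have : x ^+ 2 * (2 * (x ^+ n.+2 - y ^+ n.+2)) <= x ^+ 2 * (n.+2%:R * x ^+ n).
  by rewrite ler_wpM2l ?sqr_ge0.
have -> : x ^+ 2 * (n.+2%:R * x ^+ n) = n.+2%:R * x ^+ n.+2 by rewrite -[in RHS]addn2 exprD; ring.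
rewrite -[n.+4]addn2 natrD mulrDl; lra.
Qed.

(** Telescoping [exprB_le] compares a right Riemann sum of [u^(d/2)] with its integral. *)
Lemma sum_rtX_ge d m :
  2 * rt m.+1 ^+ d.+2 <= d.+2%:R * \sum_(j < m.+1) rt j.+1 ^+ d.
Proof.
elim: m => [|m IHm].
  by rewrite big_ord1 sqrtr1 !expr1n !mulr1 ler_nat.
rewrite big_ord_recr /= mulrDr.
have := @exprB_le d (rt m.+2) (rt m.+1) (sqrtr_ge0 _) (le_rt (leqnSn _)).
rewrite !sqr_sqrtr // -[m.+2%:R]natr1 => h; have := h ltac:(ring).
lra.
Qed.

Fixpoint ball_volume n : R :=
  match n with
  | 0 => 1
  | 1 => 2
  | m.+2 => 2 * pi / m.+2%:R * ball_volume m
  end.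

Lemma ball_volume_gt0 n : 0 < ball_volume n.
Proof.
suff H k : 0 < ball_volume k /\ 0 < ball_volume k.+1 by have [] := H n.
elim: k => [|k [IH1 IH2]] /=; first by [].
by split=> //; rewrite !mulr_gt0 ?invr_gt0 ?pi_gt0.
Qed.

(** The leading term of the count is the volume, with an error of one order less whose constant
    depends on the dimension alone. The dimension rises by two, through convolution with the disk
    bound [base2]. *)
Lemma psum_theta_ge d : exists2 C, 0 <= C & forall t m, (m <= t ^ 2)%N ->
  ball_volume d.+1 * rt m.+1 ^+ d.+1 <= psum (theta R t ^+ d.+1) m + C * rt m.+1 ^+ d.
Proof.
have pi0 := pi_gt0 R.
have rtS m : rt m.+1 <= rt m + 1.
  rewrite -(@ler_pXn2r _ 2) ?nnegrE ?addr_ge0 ?sqrtr_ge0 // sqr_sqrtr // sqrrD.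
  by rewrite sqr_sqrtr // -natr1; have := sqrtr_ge0 (m%:R : R); lra.
have volume2 : ball_volume 2 = pi by rewrite /= mulr1; field.
have base1 : exists2 C, 0 <= C & forall t m, (m <= t ^ 2)%N ->
    ball_volume 1 * rt m.+1 ^+ 1 <= psum (theta R t ^+ 1) m + C * rt m.+1 ^+ 0.
  exists 3 => // t m mt; have /andP[h1 h2] := psum_theta_bounds mt.
  by have := rtS m; rewrite !expr1 expr0 /=; lra.
have base2 : exists2 C, 0 <= C & forall t m, (m <= t ^ 2)%N ->
    ball_volume 2 * rt m.+1 ^+ 2 <= psum (theta R t ^+ 2) m + C * rt m.+1 ^+ 1.
  exists (pi + 6); first by lra.
  move=> t m mt; have := psum_theta2_ge mt; rewrite expr1 sqr_sqrtr // /= -natr1.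
  have : (pi + 2) * 1 <= (pi + 2) * rt m.+1.
    by rewrite ler_wpM2l ?rt_succ_ge1 //; lra.
  have := le_rt (leqnSn m); lra.
suff H k : (exists2 C, 0 <= C & forall t m, (m <= t ^ 2)%N ->
      ball_volume k.+1 * rt m.+1 ^+ k.+1
        <= psum (theta R t ^+ k.+1) m + C * rt m.+1 ^+ k) /\
    (exists2 C, 0 <= C & forall t m, (m <= t ^ 2)%N ->
      ball_volume k.+2 * rt m.+1 ^+ k.+2
        <= psum (theta R t ^+ k.+2) m + C * rt m.+1 ^+ k.+1) by have [] := H d.
elim: k => [|k [[C C0 IH] IH2]]; first by [].
split=> // {IH2}; have [D D0 disk] := base2.
(* The first summand is the accumulated error of the induction hypothesis ([lower]), the second the
   error of the disk bound times a crude count ([upper]). *)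
exists (pi * C + D * 3 ^+ k.+1).
  by rewrite addr_ge0 // mulr_ge0 // ?exprn_ge0 // ltW.
move=> t m mt; set x := rt m.+1; set V := ball_volume _ in IH *.
have x0 : 0 <= x by exact: sqrtr_ge0.
have xx : x ^+ 2 = m.+1%:R by rewrite sqr_sqrtr.
(* Each coefficient is weighted by a disk count of at least [pi * (m - j).+1] minus an error;
   [sum_psum] turns these linear weights into a sum of partial sums. *)
have conv : pi * \sum_(j < m.+1) psum (theta R t ^+ k.+1) j
    - D * x * psum (theta R t ^+ k.+1) m <= psum (theta R t ^+ k.+3) m.
  rewrite -[k.+3]addn2 exprD psumM sum_psum /psum !mulr_sumr -sumrB ler_sum //.
  move=> j _; rewrite mulrCA -(mulrC (theta R t ^+ k.+1)`_j) -mulrBr.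
  rewrite ler_wpM2l ?thetaX_ge0 //.
  have /disk := leq_trans (leq_subr j m) mt.
  rewrite volume2 sqr_sqrtr // expr1.
  have : D * rt (m - j).+1 <= D * x by rewrite ler_wpM2l // le_rt // ltnS leq_subr.
  rewrite /psum; lra.
have upper : D * x * psum (theta R t ^+ k.+1) m <= D * 3 ^+ k.+1 * x ^+ k.+2.
  apply: le_trans (ler_wpM2l _ (psumXM_le_rt k.+1 mt)) _; first exact: mulr_ge0.
  by rewrite exprMn -/x [x ^+ k.+2]exprS; lra.
have lower : V * \sum_(j < m.+1) rt j.+1 ^+ k.+1
    <= \sum_(j < m.+1) psum (theta R t ^+ k.+1) j + C * x ^+ k.+2.
  have -> : C * x ^+ k.+2 = \sum_(j < m.+1) C * x ^+ k.
    by rewrite sumr_const card_ord -mulr_natr -xx -mulrA -exprD addn2.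
  rewrite mulr_sumr -big_split ler_sum //= => j _.
  have jm : (j <= m)%N by rewrite -ltnS.
  apply: le_trans (IH _ _ (leq_trans jm mt)) _.
  rewrite lerD2l ler_wpM2l // lerXn2r ?nnegrE ?sqrtr_ge0 //.
  exact: le_rt.
have := sum_rtX_ge k.+1 m; rewrite -/x => hsum.
have V0 : 0 < V by exact: ball_volume_gt0.
rewrite [ball_volume k.+3]/= -/(ball_volume k.+1) -/V.
have n0 : k.+3%:R != 0 :> R by rewrite pnatr_eq0.
have nge0 : 0 <= k.+3%:R :> R by [].
move: n0 nge0 hsum; set n := k.+3%:R => n0 nge0 hsum.
have : 2 * pi / n * V * x ^+ k.+3
    <= pi * (V * \sum_(j < m.+1) rt j.+1 ^+ k.+1).
  rewrite -subr_ge0.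
  have -> : pi * (V * \sum_(j < m.+1) rt j.+1 ^+ k.+1) -
      2 * pi / n * V * x ^+ k.+3 =
    pi * V / n * (n * (\sum_(j < m.+1) rt j.+1 ^+ k.+1) - 2 * x ^+ k.+3).
    by field.
  by rewrite mulr_ge0 ?subr_ge0 // divr_ge0 // mulr_ge0 // ltW.
move=> /le_trans; apply.
have := ler_wpM2l (ltW pi0) lower; rewrite mulrDr; lra.
Qed.

End BallVolume.

(** Since [a - b = (e - t) - (c - t)], this is the inequality (x - y)^2 <= 2 x^2 + 2 y^2. It makes
    the lattice balls disjoint. *)
Lemma sqdist_le a b c e t : (a + c = b + e)%N ->
  (sqdist a b <= 2 * sqdist c t + 2 * sqdist e t)%N.
Proof.
move=> E; rewrite -(ler_nat rat) natrD !(natrM _ 2) !natr_sqdist.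
have : a%:R + c%:R = b%:R + e%:R :> rat by rewrite -!natrD E.
have := sqr_ge0 (c%:R + e%:R - 2 * t%:R : rat).
set x := a%:R; set y := b%:R; set z := c%:R; set w := e%:R; set r := t%:R.
move=> h xz; have -> : x - y = w - z by lra.
nra.
Qed.

(** * Packing lattice balls in a box *)

Section LatticePacking.
Variables (T : finType) (d F u : nat) (f : T -> 'I_d -> nat).
Let t := (4 * u)%N.
Let W := [set w : {ffun 'I_d -> 'I_(t + t).+1} | (\sum_i sqdist (w i) t <= t ^ 2)%N].

(* The lattice balls of radius [t] are centred at [f a + t].  The last summand on
   the left counts the corner [0, u]^d of the box: [9 * d * u ^ 2 > t ^ 2] for
   [d > 1], so the balls miss it. *)
Lemma lattice_packing : (0 < u)%N -> (forall a i, f a i <= F)%N ->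
    (forall a b, a != b -> 4 * t ^ 2 < \sum_i sqdist (f a i) (f b i))%N ->
  (#|T| * #|W| + (1 < d) * u.+1 ^ d <= (F + (t + t)).+1 ^ d)%N.
Proof.
move=> u0 fF sep.
pose box := {ffun 'I_d -> 'I_(F + (t + t)).+1}.
pose g (p : T * {ffun 'I_d -> 'I_(t + t).+1}) : box :=
  [ffun i => inord (f p.1 i + p.2 i)].
have gE p i : g p i = (f p.1 i + p.2 i)%N :> nat.
  by rewrite ffunE inordK // ltnS leq_add // -ltnS.
pose h (e : {ffun 'I_d -> 'I_u.+1}) : box := [ffun i => inord (e i)].
have hE e i : h e i = e i :> nat.
  rewrite ffunE inordK //; have := ltn_ord (e i); rewrite /t; lia.
have h_inj : injective h.
  by move=> e e' eq_h; apply/ffunP => i; apply/val_inj; rewrite /= -!hE eq_h.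
have g_inj : {in finset.setX [set: T] W &, injective g}.
  move=> [a w] [b w']; rewrite !inE /= => Ww Ww' eq_g.
  have E i : (f a i + w i = f b i + w' i)%N.
    by rewrite -(gE (a, w)) -(gE (b, w')) eq_g.
  have [eq_ab|/sep] := eqVneq a b.
    congr pair => //; apply/ffunP => i; apply/val_inj.
    by move: (E i); rewrite eq_ab => /addnI.
  rewrite ltnNge => /negP[].
  apply: leq_trans (leq_sum _ (fun i _ => sqdist_le t (E i))) _.
  rewrite big_split /= -!big_distrr /=; lia.
have cardP : #|g @: finset.setX [set: T] W| = (#|T| * #|W|)%N.
  by rewrite card_in_imset // cardsX cardsT.
have cardE : #|h @: [set: {ffun _ -> _}]| = (u.+1 ^ d)%N.
  by rewrite card_imset // cardsT card_ffun !card_ord.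
have cardB : #|{: box}| = ((F + (t + t)).+1 ^ d)%N by rewrite card_ffun !card_ord.
rewrite -cardP -cardE -cardB; case: ltnP => [d1|_]; last first.
  by rewrite mul0n addn0 max_card.
rewrite mul1n -cardsUI.
rewrite (_ : _ :&: _ = finset.set0) ?cards0 ?addn0 ?max_card //.
apply/setP => y; rewrite !inE; apply/negP => /andP[/imsetP[[a w] aw yg] /imsetP[e _ ye]].
move: aw; rewrite !inE /= => Ww.
(* Here [w i <= e i <= u] and [t = 4 * u], so every coordinate is at least [3 * u] away from the
   centre. *)
have far i : (9 * u ^ 2 <= sqdist (w i) t)%N.
  have : (f a i + w i = e i)%N by rewrite -(gE (a, w)) -yg ye hE.
  have := ltn_ord (e i); rewrite ltnS => eu ew.
  rewrite (_ : 9 * u ^ 2 = (3 * u) ^ 2)%N; last by rewrite expnMn.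
  rewrite /sqdist leq_sqr; move: eu ew.
  move: (nat_of_ord (w i)) (nat_of_ord (e i)) => n m.
  rewrite /t; clear; move: (f a i) => k; lia.
have : (\sum_(i < d) 9 * u ^ 2 <= t ^ 2)%N.
  by apply: leq_trans (leq_sum _ (fun i _ => far i)) Ww.
rewrite sum_nat_const card_ord /t expnMn.
have : (0 < u ^ 2)%N by rewrite expn_gt0 u0.
nia.
Qed.

End LatticePacking.

(** * From lattice points to real points *)

Section Packing.
Variables (R : realType) (d : nat).
Implicit Types (x y v : 'rV[R]_d) (A : {fset 'rV[R]_d}).

Lemma eucl_dist_sqr x y : eucl_dist x y ^+ 2 = \sum_(i < d) (x 0 i - y 0 i) ^+ 2.
Proof. by rewrite /eucl_dist sqr_sqrtr // sumr_ge0 // => i _; rewrite sqr_ge0. Qed.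

Variables (delta l : R) (v : 'rV[R]_d) (A : {fset 'rV[R]_d}).
Hypotheses (delta0 : 0 < delta) (l0 : 0 <= l).
Hypothesis A_cube : forall x, x \in A -> forall i, v 0 i <= x 0 i <= v 0 i + l.
Hypothesis A_sep : forall x y, x \in A -> y \in A -> x != y -> delta <= eucl_dist x y.

Lemma lattice_packing_cube u : (0 < u)%N ->
  #|` A|%:R * psum (theta R (4 * u) ^+ d) ((4 * u) ^ 2) + ((1 < d) * u.+1 ^ d)%N%:R
    <= ((8 * u + d + 1)%:R * (l / delta) + (8 * u + 1)%:R) ^+ d.
Proof.
move=> u0; have [t tE] : exists t, t = (4 * u)%N by exists (4 * u)%N.
(* The lattice centres must stay more than [2 * t = 8 * u] apart. The extra [d + 1] absorbs the
   rounding, as (2 t + d + 1)^2 > 4 t^2 + d (4 t + 1). *)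
rewrite -tE; set s : R := (8 * u + d + 1)%:R / delta.
have s0 : 0 < s by rewrite divr_gt0 // ltr0n addn1.
pose f (a : A) (i : 'I_d) := Num.truncn (s * (val a 0 i - v 0 i)).
have inA (a : A) i : 0 <= s * (val a 0 i - v 0 i) <= s * l.
  have /andP[h1 h2] := A_cube (valP a) i.
  by rewrite mulr_ge0 ?ler_pM2l ?subr_ge0 ?(ltW s0) //; lra.
have fF a i : (f a i <= Num.truncn (s * l))%N.
  by have /andP[h1 h2] := inA a i; exact: le_truncn.
have f_itv a i : (f a i)%:R <= s * (val a 0 i - v 0 i) < (f a i)%:R + 1.
  by rewrite natr1; have /andP[h1 _] := inA a i; exact: truncn_itv.
have sep a b : a != b -> (4 * t ^ 2 < \sum_i sqdist (f a i) (f b i))%N.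
  move=> neq_ab; rewrite ltnNge; apply/negP => le4t.
  (* Rounding changes a coordinate difference by at most 1, and the rounded difference is at most
     [2 * t] in absolute value. *)
  have ub i : (s * (val a 0 i - val b 0 i)) ^+ 2
      <= (sqdist (f a i) (f b i))%:R + (4 * t + 1)%:R.
    have : (sqdist (f a i) (f b i) <= (2 * t) ^ 2)%N.
      apply: leq_trans (leq_trans le4t _); last by rewrite expnMn.
      by rewrite (bigD1 i) //= leq_addr.
    rewrite -(ler_nat R) natrX natr_sqdist natrD !natrM.
    have /andP[] := f_itv a i; have /andP[] := f_itv b i.
    set p := (f a i)%:R; set q := (f b i)%:R; set T := t%:R.
    have T0 : 0 <= T by [].
    move=> q1 q2 p1 p2 pqT.
    have : `|p - q| <= 2 * T.
      by rewrite -(@ler_pXn2r _ 2) ?nnegrE ?mulr_ge0 // real_normK ?num_real.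
    rewrite ler_norml => /andP[h1 h2].
    set z := s * _; have : `|z - (p - q)| <= 1.
      by rewrite ler_norml /z; rewrite !mulrBr in p1 p2 q1 q2 *; lra.
    rewrite ler_norml => /andP[z1 z2]; nra.
  have : s ^+ 2 * delta ^+ 2 <= s ^+ 2 * eucl_dist (val a) (val b) ^+ 2.
    rewrite ler_pM2l ?exprn_gt0 // ler_pXn2r ?nnegrE ?(ltW delta0) ?sqrtr_ge0 //.
    by apply: A_sep; [exact: valP|exact: valP|rewrite (inj_eq val_inj)].
  rewrite eucl_dist_sqr mulr_sumr.
  under eq_bigr do rewrite -exprMn.
  move=> /le_trans /(_ (ler_sum _ (fun i _ => ub i))).
  rewrite big_split /= -natr_sum sumr_const card_ord -mulrnA -natrD.
  rewrite -exprMn /s divfK ?gt_eqF // -natrX ler_nat => H.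
  have := leq_trans H (leq_add le4t (leqnn _)); rewrite tE; nia.
have := lattice_packing u0 fF; rewrite -tE => /(_ sep).
rewrite -cardfE -(ler_nat R) natrD natrM natrX (card_lattice_ball R) => /le_trans; apply.
rewrite lerXn2r ?nnegrE //.
  by rewrite addr_ge0 // mulr_ge0 // divr_ge0 // ltW.
rewrite -addn1 -addnA natrD (_ : (8 * u + d + 1)%:R * _ = s * l); last first.
  by rewrite /s; field; rewrite gt_eqF.
rewrite lerD //; first by rewrite truncn_le mulr_ge0 // ltW.
by rewrite ler_nat tE; lia.
Qed.

(** In units of the ball radius [delta / 2], the enlarged cube has side [2 * (l / delta) + 2] and
    the missed corner has side 1/4. The bound is the limit of [lattice_packing_cube], divided by the
    [d]-th power of [4 * u], as [u] grows. *)
Lemma packing_le : (0 < d)%N ->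
  #|` A|%:R * ball_volume R d + (1 < d)%N%:R / 4 ^+ d <= (2 * (l / delta) + 2) ^+ d.
Proof.
move: lattice_packing_cube; move: #|` A| => m; clear -delta0 l0.
case: d => // n lattice _.
have [C C0 volume_le] := psum_theta_ge R n.
set N := m%:R in lattice *; set la := l / delta in lattice *.
have la0 : 0 <= la by rewrite divr_ge0 // ltW.
set V := ball_volume R n.+1 in volume_le *; have V0 : 0 < V by exact: ball_volume_gt0.
set c : R := (1 < n.+1)%N%:R.
(* All errors are collected in a polynomial in [1 / t]; continuity at 0 then gives the limit. *)
pose P : {poly R} := ((2 * la + 2)%:P + (n.+2%:R * la + 1) *: 'X) ^+ n.+1
  + (N * C) *: ((1 + 'X) ^+ n * 'X).
have PE h : P.[h] = (2 * la + 2 + (n.+2%:R * la + 1) * h) ^+ n.+1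
    + N * C * ((1 + h) ^+ n * h).
  by rewrite /P !hornerE.
suff bound k : N * V + c / 4 ^+ n.+1 <= P.[harmonic k / 4].
  have -> : (2 * la + 2) ^+ n.+1 = P.[0] by rewrite PE !mulr0 !addr0.
  have h0 : (harmonic k / 4 @[k --> \oo] --> (0 : R))%classic.
    by rewrite -(mul0r 4^-1); apply: cvgM cvg_harmonic (cvg_cst _).
  have hP : (P.[harmonic k / 4] @[k --> \oo] --> P.[0])%classic.
    by apply: continuous_cvg h0; exact: continuous_horner.
  by apply: cvgr_to_ge hP _; exact: nearW.
set u := k.+1; set t : R := 4 * u%:R; have t0 : 0 < t by rewrite mulr_gt0.
have -> : harmonic k / 4 = t^-1 by rewrite /t invfM mulrC.
set x := Num.sqrt ((4 * u) ^ 2).+1%:R : R.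
have x2 : x ^+ 2 = t ^+ 2 + 1 by rewrite sqr_sqrtr // -natr1 natrX natrM.
have x0 : 0 <= x by exact: sqrtr_ge0.
have tx : t <= x by rewrite -(@ler_pXn2r _ 2) ?nnegrE ?(ltW t0) // x2; lra.
have xt : x <= t + 1.
  by rewrite -(@ler_pXn2r _ 2) ?nnegrE ?addr_ge0 ?(ltW t0) // x2 sqrrD; lra.
have := volume_le (4 * u)%N ((4 * u) ^ 2)%N (leqnn _); rewrite -/x => vol.
have := lattice u isT; set p := psum _ _ in vol *.
rewrite natrM natrX -/c !natrD natrM => lat.
have : N * V * t ^+ n.+1 + c * u%:R ^+ n.+1 <=
    ((2 * t + n.+2%:R) * la + (2 * t + 1)) ^+ n.+1 + N * C * (t + 1) ^+ n.
  have h1 : N * (V * t ^+ n.+1) <= N * (p + C * (t + 1) ^+ n).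
    rewrite ler_wpM2l //; apply: le_trans (le_trans vol _).
      by rewrite ler_pM2l // lerXn2r // nnegrE ltW.
    by rewrite lerD2l ler_wpM2l // lerXn2r // nnegrE addr_ge0 // ltW.
  have h2 : c * u%:R ^+ n.+1 <= c * u.+1%:R ^+ n.+1.
    by rewrite ler_wpM2l // lerXn2r ?nnegrE // ler_nat.
  have -> : (2 * t + n.+2%:R) * la + (2 * t + 1) =
      (8 * u%:R + n.+1%:R + 1) * la + (8 * u%:R + 1).
    by rewrite /t -[n.+2%:R]natr1; ring.
  lra.
have ti0 : 0 < t^-1 ^+ n.+1 by rewrite exprn_gt0 ?invr_gt0.
rewrite -(ler_pM2r ti0) [leLHS]mulrDl [leRHS]mulrDl -[X in _ <= X + _]exprMn.
have tn (i : nat) : t ^+ i * t^-1 ^+ i = 1 by rewrite -exprMn divff ?gt_eqF // expr1n.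
have -> : N * V * t ^+ n.+1 * t^-1 ^+ n.+1 = N * V by rewrite -mulrA tn mulr1.
have -> : c * u%:R ^+ n.+1 * t^-1 ^+ n.+1 = c / 4 ^+ n.+1.
  rewrite -mulrA -exprMn -exprVn; congr (_ * _ ^+ _).
  by rewrite /t; field; rewrite pnatr_eq0.
rewrite PE => /le_trans; apply.
have -> : ((2 * t + n.+2%:R) * la + (2 * t + 1)) / t =
   2 * la + 2 + (n.+2%:R * la + 1) / t by field; rewrite gt_eqF.
have <- : (t + 1) ^+ n * t^-1 ^+ n.+1 = (1 + t^-1) ^+ n * t^-1.
  by rewrite exprSr mulrA -exprMn mulrDl divff ?gt_eqF // mul1r.
by rewrite mulrA.
Qed.

End Packing.

(** * The constant kappa and the strict packing bound *)

Section Kappa.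
Variable R : realType.

Lemma ball_volume_even n : ball_volume R n.*2 = pi ^+ n / n`!%:R.
Proof.
elim: n => [|n IHn]; first by rewrite expr0 divr1.
rewrite doubleS /= IHn factS natrM exprS -[n.*2.+2]doubleS -muln2 natrM.
have : n`!%:R != 0 :> R by rewrite pnatr_eq0 -lt0n fact_gt0.
have : n.+1%:R != 0 :> R by rewrite pnatr_eq0.
by move: n`!%:R n.+1%:R => P Q P0 Q0; field; rewrite P0 Q0.
Qed.

Lemma odd_prod_rec n : (\prod_(1 <= i < n.+3 | odd i) i =
  (\prod_(1 <= i < n.+1 | odd i) i) * (if odd n then n.+2 else n.+1))%N.
Proof.
rewrite big_mkcond big_nat_recr //= big_nat_recr //= -big_mkcond /= negbK.
by case: odd => /=; rewrite muln1.
Qed.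

Lemma ball_volume_odd n : ball_volume R n.*2.+1 =
  2 * (2 * pi) ^+ n / (\prod_(1 <= i < n.*2.+2 | odd i) i)%N%:R.
Proof.
elim: n => [|n IHn]; first by rewrite big_mkcond big_nat1 expr0 mulr1 divr1.
rewrite doubleS [ball_volume R _]/= -/(ball_volume R n.*2.+1) IHn odd_prod_rec /= odd_double /=.
rewrite natrM exprS.
have H : (\prod_(1 <= i < n.*2.+2 | odd i) i)%N%:R != 0 :> R.
  rewrite pnatr_eq0 -lt0n prodn_cond_gt0 // => i; by case: i.
have H2 : n.*2.+3%:R != 0 :> R by rewrite pnatr_eq0.
by move: H H2; set P := _%:R; set Q := _%:R; move: P Q => P Q H H2; field; rewrite H H2.
Qed.

Lemma kappa_ge d : 3 ^+ d / ball_volume R d <= (kappa R d)%:~R.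
Proof.
have dE := odd_double_half d; rewrite /kappa.
case: ifP dE => _ dE; last first.
  rewrite -[in ball_volume R d]dE ball_volume_even invf_div mulrA.
  exact: ceil_ge.
have -> : ball_volume R d =
    2 * (2 * pi) ^+ d./2 / (\prod_(1 <= i < d.+1 | odd i) i)%N%:R.
  by rewrite -[in RHS]dE /= uphalf_double -[in LHS]dE ball_volume_odd.
by rewrite invf_div mulrA; exact: ceil_ge.
Qed.

(** In dimension 1 no corner is missed; strictness comes from the ceiling, which raises 3/2 to 2. *)
Lemma kappa1_ge : 2 <= (kappa R 1)%:~R :> R.
Proof.
have := kappa_ge 1; rewrite expr1 /= => H.
have : 1 < (kappa R 1)%:~R :> R by lra.
by rewrite -[1]/(1%:~R) ltr_int -[2]/(2%:~R) ler_int.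
Qed.

(** The hypothesis on [l] gives [2 * la + 2 <= 3 * la]. For [1 < d] the corner term makes the bound
    strict, for [d = 1] [kappa1_ge] does. *)
Lemma packing_lt d (delta l : R) (v : 'rV[R]_d) (A : {fset 'rV[R]_d}) :
    (0 < d)%N -> 0 < delta -> 2 * delta <= l ->
    (forall x, x \in A -> forall i, v 0 i <= x 0 i <= v 0 i + l) ->
    (forall x y, x \in A -> y \in A -> x != y -> delta <= eucl_dist x y) ->
  #|` A|%:R < (kappa R d)%:~R * (l / delta) ^+ d.
Proof.
move=> d0 delta0 ll A_cube A_sep.
have l0 : 0 < l by lra.
have := packing_le delta0 (ltW l0) A_cube A_sep d0.
move: #|` A| => N; clear A_cube A_sep v A.
have V0 := ball_volume_gt0 R d.
set la := l / delta; have la2 : 2 <= la by rewrite ler_pdivlMr.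
have [|d1] := ltnP 1 d; last first.
  have -> : d = 1%N by lia.
  move: kappa1_ge; rewrite mul0r addr0 !expr1 /=; nra.
move=> _ H.
have {}H : N%:R * ball_volume R d < (3 * la) ^+ d.
  have : (2 * la + 2) ^+ d <= (3 * la) ^+ d.
    by rewrite lerXn2r ?nnegrE; lra.
  have : 0 < 1 / 4 ^+ d :> R by rewrite divr_gt0 ?exprn_gt0.
  by move: H => /=; lra.
rewrite -(ltr_pM2r V0); apply: lt_le_trans H _.
rewrite exprMn mulrAC ler_wpM2r ?exprn_ge0 //; first by lra.
by rewrite -ler_pdivrMr // kappa_ge.
Qed.

End Kappa.

Local Open Scope fset_scope.
Local Open Scope ring_scope.

(** * Approximate grids and one density step *)

Section Grid.
Variables (R : realType) (d : nat).
Implicit Types (x y v w : 'rV[R]_d) (A Q : {fset 'rV[R]_d}).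

Lemma eucl_dist_le x y (h : R) : 0 <= h -> (forall i, `|x 0 i - y 0 i| <= h) ->
  eucl_dist x y <= Num.sqrt d%:R * h.
Proof.
move=> h0 xyh; rewrite -[leRHS]ger0_norm ?mulr_ge0 ?sqrtr_ge0 // -sqrtr_sqr.
rewrite ler_wsqrtr // exprMn sqr_sqrtr // mulr_natl -[X in _ *+ X]card_ord -sumr_const.
rewrite ler_sum // => i _; rewrite -real_normK ?num_real //.
by rewrite lerXn2r ?nnegrE.
Qed.

Lemma eucl_dist_ge x y i : `|x 0 i - y 0 i| <= eucl_dist x y.
Proof.
rewrite -sqrtr_sqr ler_wsqrtr // (bigD1 i) //= lerDl sumr_ge0 // => j _.
exact: sqr_ge0.
Qed.

Lemma min_dist_ge (S : set 'rV[R]_d) (m : R) :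
  (forall x y, S x -> S y -> x <> y -> m <= eucl_dist x y) -> (m%:E <= min_dist S)%E.
Proof.
by move=> Sm; apply: le_ereal_inf_tmp => _ [x [y [Sx Sy xy ->]]]; rewrite lee_fin Sm.
Qed.

Lemma delta_separatedP (delta : R) (S : set 'rV[R]_d) x y :
  delta_separated delta S -> S x -> S y -> x <> y -> delta <= eucl_dist x y.
Proof.
move=> sepS Sx Sy xy; rewrite -lee_fin; apply: le_trans sepS _.
by apply: ereal_inf_lbound; exists x, y.
Qed.

(** The lower corners of the cells form the exact grid: its minimum distance is at least [lam], and
    each chosen point is within the cell diagonal [Num.sqrt d%:R * h] of its corner. *)
Lemma approx_grid_of_cells k (eps lam h : R) w (X : {ffun 'I_d -> 'I_k} -> 'rV[R]_d) :
    0 < lam -> 0 < eps -> 0 <= h -> Num.sqrt d%:R * h <= eps * lam -> injective X ->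
    (forall (a : {ffun 'I_d -> 'I_k}) i,
       w 0 i + (a i)%:R * lam <= X a 0 i <= w 0 i + (a i)%:R * lam + h) ->
  approx_grid eps k [fset X a | a in {ffun 'I_d -> 'I_k}].
Proof.
move=> lam0 eps0 h0 hlam X_inj X_cell.
pose P := std_grid R d k; pose gp (a : {ffun 'I_d -> 'I_k}) : 'rV[R]_d := \row_(i < d) (a i).+1%:R.
have gp_inj : injective gp.
  move=> a b /rowP eq_ab; apply/ffunP => i; apply/val_inj/eqP.
  by move: (eq_ab i); rewrite !mxE => /eqP; rewrite eqr_nat eqSS.
(* Labels are positions in the enumeration of the grid; [code] and [rank] translate between
   positions and multi-indices. *)
pose pts (i : 'I_#|` P|) : 'rV[R]_d := nth 0 P i.
have ptsP i : pts i \in P by rewrite mem_nth.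
have pts_inj : injective pts.
  by move=> i j /eqP; rewrite nth_uniq ?fset_uniq // => /eqP /val_inj.
have /choice[code codeE] i : exists a, pts i = gp a.
  by have /imfsetP[a _ ->] := ptsP i; exists a.
have /choice[rank rankE] a : exists i, pts i = gp a.
  have /(nthP 0)[i ltiP <-] : gp a \in P by apply/imfsetP; exists a.
  by exists (Ordinal ltiP).
have code_inj : injective code.
  by move=> i j eq_ij; apply: pts_inj; rewrite !codeE eq_ij.
have rankK a : code (rank a) = a by apply: gp_inj; rewrite -codeE rankE.
(* The shift by [lam] compensates for the coordinates of [std_grid] starting at 1. *)
pose tr : 'rV[R]_d := w - const_mx lam.
have trE (a : {ffun 'I_d -> 'I_k}) i : (lam *: gp a + tr) 0 i = w 0 i + (a i)%:R * lam.
  by rewrite !mxE -natr1; ring.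
exists [fset lam *: (p : 'rV[R]_d) + tr | p in P], (X \o code), (fun i => lam *: pts i + tr).
split.
- by exists lam, tr.
- apply/fsetP => y; apply/imfsetP/imfsetP => /= [[p /(nthP 0)[i ltiP <-] ->]|[i _ ->]].
    by exists (Ordinal ltiP).
  by exists (pts i).
- exact: inj_comp.
- apply/fsetP => y; apply/imfsetP/imfsetP => /= [[a _ ->]|[i _ ->]].
    by exists (rank a); rewrite //= rankK.
  by exists (code i).
move=> i; apply: (@le_trans _ _ (eps%:E * lam%:E)%E).
  rewrite -EFinM lee_fin; apply: le_trans hlam; apply: eucl_dist_le => // j.
  rewrite codeE trE /=; have /andP[h1 h2] := X_cell (code i) j.
  by rewrite ger0_norm; lra.
rewrite lee_pmul2l // ?lte_fin //; apply: min_dist_ge => x y /=.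
move=> /imfsetP[_ /imfsetP[a _ ->] ->] /imfsetP[_ /imfsetP[b _ ->] ->] neq_ab.
have [j neq_j] : exists j, a j != b j.
  apply/existsP; apply: contra_notT neq_ab => /existsPn eq_ab.
  by congr (_ *: gp _ + _); apply/ffunP => j; apply/eqP; rewrite -[_ == _]negbK.
apply: le_trans (eucl_dist_ge _ _ j); rewrite !trE.
have -> : w 0 j + (a j)%:R * lam - (w 0 j + (b j)%:R * lam) = ((a j)%:R - (b j)%:R) * lam by ring.
rewrite normrM (gtr0_norm lam0) ler_pMl //.
have [lt_ab|lt_ba|/val_inj eq_ab] := ltngtP (a j) (b j); last by rewrite eq_ab eqxx in neq_j.
  by rewrite distrC -natrB 1?ltnW // normr_nat ler1n subn_gt0.
by rewrite -natrB 1?ltnW // normr_nat ler1n subn_gt0.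
Qed.

Lemma card_fset_filter_sum A (p : pred 'rV[R]_d) :
  #|` [fset x in A | p x]| = (\sum_(x <- A) p x)%N.
Proof. by rewrite card_fset_sum1 big_fset /= big_mkcond; apply: eq_bigr => x _; case: (p x). Qed.

Lemma density_step (k s : nat) (eps l : R) v A :
    (0 < k)%N -> (1 < s)%N -> 0 < l -> 0 < eps -> Num.sqrt d%:R <= eps * s%:R ->
    (forall x, x \in A -> forall i, v 0 i <= x 0 i <= v 0 i + l) ->
  (exists2 Q, {subset Q <= A} & approx_grid eps k Q) \/
  (exists A' v', [/\ {subset A' <= A},
     forall x, x \in A' -> forall i, v' 0 i <= x 0 i <= v' 0 i + l / (k * s)%N%:R &
     (#|` A| <= (k ^ d - 1) * s ^ d * #|` A'|)%N]).
Proof.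
move=> k0 s1 l0 eps0 sqrtd A_cube; have s0 := ltnW s1.
set h := l / (k * s)%N%:R.
have ks0 : 0 < (k * s)%N%:R :> R by rewrite ltr0n muln_gt0 k0.
have h0 : 0 < h by rewrite divr_gt0.
have hl : (k * s)%N%:R * h = l by rewrite /h mulrC divfK ?gt_eqF.
pose cell (b : {ffun 'I_d -> 'I_s}) (a : {ffun 'I_d -> 'I_k}) x :=
  [forall i, v 0 i + (a i * s + b i)%N%:R * h <= x 0 i <= v 0 i + (a i * s + b i)%N%:R * h + h].
have cellP x : x \in A -> exists b a, cell b a x.
  move=> /A_cube x_cube.
  have idx i : exists g : 'I_(k * s), v 0 i + g%:R * h <= x 0 i <= v 0 i + g%:R * h + h.
    have /andP[x1 x2] := x_cube i.
    have xi0 : 0 <= (x 0 i - v 0 i) / h by rewrite divr_ge0 ?subr_ge0 // ltW.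
    have /andP[n1 n2] := truncn_itv xi0; set n := Num.truncn _ in n1 n2.
    rewrite ler_pdivlMr // in n1; rewrite ltr_pdivrMr // -natr1 in n2.
    have [lt_n|le_n] := ltnP n (k * s).
      by exists (Ordinal lt_n) => /=; lra.
    (* Only points on the far face get here; they belong to the last closed cell. *)
    have lt_ks : ((k * s).-1 < k * s)%N by rewrite prednK // muln_gt0 k0.
    exists (Ordinal lt_ks) => /=.
    have : (k * s)%N%:R <= n%:R :> R by rewrite ler_nat.
    rewrite -(ler_pM2r h0) hl => le_l.
    have : (k * s).-1%:R * h + h = l by rewrite -hl -{2}(ltn_predK lt_ks) -natr1; ring.
    lra.
  have [g gP] := fin_all_exists idx.
  (* Division by [s] splits a cell index into its block and its position in the block. *)
  have lt_a i : (g i %/ s < k)%N by rewrite ltn_divLR.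
  have lt_b i : (g i %% s < s)%N by rewrite ltn_mod.
  exists [ffun i => Ordinal (lt_b i)], [ffun i => Ordinal (lt_a i)].
  by apply/forallP => i; rewrite !ffunE /= -divn_eq.
case: (pselect (exists b, forall a, exists2 x, x \in A & cell b a x)) => [[b full]|].
  left; have /choice[X XP] a : exists x, x \in A /\ cell b a x.
    by have [x] := full a; exists x.
  exists [fset X a | a in {ffun 'I_d -> 'I_k}].
    by move=> _ /imfsetP[a _ ->]; have [] := XP a.
  apply: (@approx_grid_of_cells k eps (s%:R * h) h (\row_i (v 0 i + (b i)%:R * h))) => //.
  - by rewrite mulr_gt0 ?ltr0n.
  - exact: ltW.
  - by rewrite mulrA ler_pM2r.
  - move=> a a' eq_X; apply/ffunP => i; apply/val_inj.
    have [_ /forallP/(_ i)] := XP a; have [_ /forallP/(_ i)] := XP a'; rewrite eq_X.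
    (* As [1 < s], closed cells with the same position in different blocks are separated by a
       gap. *)
    have sep (m n : nat) : (m < n)%N ->
        (m * s + b i)%N%:R * h + h < (n * s + b i)%N%:R * h.
      move=> lt_mn; rewrite -[X in _ + X]mul1r -mulrDl ltr_pM2r // natr1 ltr_nat.
      by rewrite -addSn ltn_add2r; nia.
    by case: (ltngtP (a i) (a' i)) => // /sep H /andP[h1 h2] /andP[h3 h4]; exfalso; lra.
  - move=> a i; have [_ /forallP/(_ i)] := XP a; rewrite !mxE natrD natrM.
    set z := X a 0 i; lra.
move=> no_full; right.
have /choice[bad badP] b : exists a, forall x, x \in A -> ~~ cell b a x.
  apply: contra_notP no_full => Hb; exists b => a.
  apply: contra_notP Hb => Ha; exists a => x xA; apply/negP => cx.
  by apply: Ha; exists x.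
pose part (p : {ffun 'I_d -> 'I_s} * {ffun 'I_d -> 'I_k}) := [fset x in A | cell p.1 p.2 x].
pose p0 : {ffun 'I_d -> 'I_s} * {ffun 'I_d -> 'I_k} := ([ffun=> Ordinal s0], [ffun=> Ordinal k0]).
pose pm := [arg max_(p > p0) #|` part p|]%N.
exists (part pm), (\row_i (v 0 i + (pm.2 i * s + pm.1 i)%N%:R * h)); split.
- by move=> x; rewrite !inE => /andP[].
- by move=> x; rewrite !inE => /andP[_ /forallP xc] i; rewrite mxE; exact: xc.
have le_max p : (#|` part p| <= #|` part pm|)%N.
  by rewrite /pm; case: arg_maxnP => // q _; apply.
(* Every point lies in some cell and none in a cell [(b, bad b)]. Closed cells may share points,
   which only enlarges the right side. *)
apply: (@leq_trans (\sum_b \sum_(a | a != bad b) #|` part (b, a)|)).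
  under eq_bigr => b _ do under eq_bigr => a _ do rewrite card_fset_filter_sum.
  rewrite card_fset_sum1.
  rewrite pair_big_dep /= exchange_big /= big_seq [leqRHS]big_seq.
  apply: leq_sum => x xA.
  have [b [a cx]] := cellP x xA.
  rewrite (bigD1 (b, a)) /= ?cx //.
  by apply: contraTneq cx => ->; exact: badP.
apply: (@leq_trans (\sum_(b : {ffun 'I_d -> 'I_s}) \sum_(a | a != bad b) #|` part pm|)).
  by apply: leq_sum => b _; apply: leq_sum => a _.
under eq_bigr => b _ do rewrite sum_nat_const cardC1 card_ffun !card_ord.
by rewrite sum_nat_const card_ffun !card_ord subn1; nia.
Qed.

End Grid.

(** * Iteration and the explicit threshold *)

Section Threshold.
Variables (R : realType) (d : nat).
Implicit Types (v : 'rV[R]_d) (A Q : {fset 'rV[R]_d}).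

Lemma density_iterate (k s : nat) (eps l : R) v A n :
    (0 < k)%N -> (1 < s)%N -> 0 < l -> 0 < eps -> Num.sqrt d%:R <= eps * s%:R ->
    (forall x, x \in A -> forall i, v 0 i <= x 0 i <= v 0 i + l) ->
    (forall Q, {subset Q <= A} -> ~ approx_grid eps k Q) ->
  exists A' v', [/\ {subset A' <= A},
     forall x, x \in A' -> forall i, v' 0 i <= x 0 i <= v' 0 i + l / (k * s)%N%:R ^+ n &
     (#|` A| <= ((k ^ d - 1) * s ^ d) ^ n * #|` A'|)%N].
Proof.
move=> k0 s1 l0 eps0 sqrtd A_cube nogrid.
have ks0 : 0 < (k * s)%N%:R :> R by rewrite ltr0n muln_gt0 k0 ltnW.
elim: n => [|n [A' [v' [subA A'_cube leA]]]].
  by exists A, v; rewrite expn0 mul1n expr0 divr1; split.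
have l'0 : 0 < l / (k * s)%N%:R ^+ n by rewrite divr_gt0 ?exprn_gt0.
have [[Q QA' Qgrid]|] := density_step k0 s1 l'0 eps0 sqrtd A'_cube.
  by case: (nogrid Q) => // x /QA' /subA.
move=> [A'' [v'' [subA' A''_cube leA']]]; exists A'', v''; split.
- by move=> x /subA' /subA.
- by move=> x xA i; rewrite exprSr invfM mulrA; exact: A''_cube.
by rewrite expnSr -mulnA (leq_trans leA) // leq_mul2l leA' orbT.
Qed.

Lemma kappa_le_grid_j (k : nat) (c delta : R) : (0 < d)%N -> (1 < k)%N ->
    0 < c -> 0 < delta ->
  (kappa R d)%:~R / (c * delta ^+ d) <=
    grid_r R d k ^+ absz (Num.max 0 (grid_j d k c delta)).
Proof.
move=> d0 k1 c0 delta0.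
have kd1 : (1 < k ^ d)%N by rewrite -(exp1n d) ltn_exp2r.
have r1 : 1 < grid_r R d k.
  have : 1 < (k ^ d)%N%:R :> R by rewrite ltr1n.
  by move=> H; rewrite /grid_r ltr_pdivlMr; lra.
have r0 : 0 < grid_r R d k by lra.
have lnr0 : 0 < ln (grid_r R d k) by rewrite ln_gt0.
have kappa0 : 0 < (kappa R d)%:~R :> R.
  apply: lt_le_trans (kappa_ge R d); rewrite divr_gt0 ?exprn_gt0 //.
  exact: ball_volume_gt0.
rewrite -ler_ln ?posrE ?divr_gt0 ?mulr_gt0 ?exprn_gt0 // lnXn //.
rewrite -mulr_natl -ler_pdivrMr //; apply: le_trans (ceil_ge _) _.
by rewrite natr_absz ger0_norm ?le_max ?lexx // ler_int le_max lexx orbT.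
Qed.

(** The bound on [eps] forces a ceiling of at least 3, hence the condition [1 < s] of
    [density_step]. *)
Lemma grid_sE (eps : R) : (0 < d)%N -> 0 < eps -> eps <= 1 / 3 ->
  exists s : nat, [/\ grid_s d eps = s, (1 < s)%N & Num.sqrt d%:R <= eps * s%:R].
Proof.
move=> d0 eps0 eps3; have : Num.sqrt d%:R / eps <= (grid_s d eps)%:~R := ceil_ge _.
have sq1 : 1 <= Num.sqrt d%:R :> R by rewrite -[leLHS]sqrtr1 ler_wsqrtr // ler1n.
have : 3 <= Num.sqrt d%:R / eps by rewrite ler_pdivlMr //; lra.
move=> h1 h2; have : 3 <= (grid_s d eps)%:~R :> R by apply: le_trans h2.
case: (grid_s d eps) h2 => s h2; rewrite -[3]/(3%:~R) ler_int // => s3.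
exists s; split=> //; first by lia.
by move: h2; rewrite ler_pdivrMr // mulrC.
Qed.

Lemma grid_threshold_explicit (k : nat) (c delta eps : R) :
    (0 < d)%N -> (0 < k)%N -> 0 < c -> 0 < delta -> 0 < eps -> eps <= 1 / 3 ->
  0 < Z0_explicit d k c delta eps /\
  grid_threshold d k c delta eps (Z0_explicit d k c delta eps).
Proof.
move=> d0 k0 c0 delta0 eps0 eps3; have [s [sE s1 sqrtd]] := grid_sE d0 eps0 eps3.
have ks0 : 0 < (k * s)%N%:R :> R by rewrite ltr0n muln_gt0 k0 ltnW.
set n := absz (Num.max 0 (grid_j d k c delta)).
have -> : Z0_explicit d k c delta eps = 2 * delta * (k * s)%N%:R ^+ n.
  rewrite /Z0_explicit sE -[s%:~R]/(s%:R) -natrM; congr (_ * _).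
  by rewrite -[_ ^+ n]/(_ ^ (n%:Z)) /n gez0_abs // le_max lexx.
have Z0 : 0 < 2 * delta * (k * s)%N%:R ^+ n by rewrite !mulr_gt0 ?exprn_gt0.
split=> // L S ZL sepS S_cube [A AS A_card]; have L0 := lt_le_trans Z0 ZL.
apply: contrapT => nogrid.
have A_cube x : x \in A -> forall i, (0 : 'rV[R]_d) 0 i <= x 0 i <= (0 : 'rV[R]_d) 0 i + L.
  by move=> /AS /S_cube xL i; rewrite mxE add0r; exact: xL.
have nogridA Q : {subset Q <= A} -> ~ approx_grid eps k Q.
  by move=> QA Qgrid; apply: nogrid; exists Q => // x /QA /AS.
have iter m := density_iterate m k0 s1 L0 eps0 sqrtd A_cube nogridA.
have cL0 : 0 < c * L ^+ d by rewrite mulr_gt0 ?exprn_gt0.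
(* For [k = 1] the factor [k ^ d - 1] vanishes, so a single step already makes [A] empty. *)
have [k1|] := ltnP 1 k; last first.
  move=> k1; have kE : k = 1%N by lia.
  have [A' [v' [_ _]]] := iter 1%N.
  rewrite kE exp1n subnn expn1 !mul0n leqn0 => /eqP A0.
  by move: A_card; rewrite A0 leNgt cL0.
have [A' [v' [subA A'_cube]]] := iter n.
rewrite -(ler_nat R) => leA.
have A'_sep x y : x \in A' -> y \in A' -> x != y -> delta <= eucl_dist x y.
  move=> /subA /AS xS /subA /AS yS /eqP xy; exact: (delta_separatedP sepS).
(* The threshold is chosen so that after [n] subdivisions the side still admits [packing_lt]. *)
have side : 2 * delta <= L / (k * s)%N%:R ^+ n by rewrite ler_pdivlMr ?exprn_gt0.
have := packing_lt d0 delta0 side A'_cube A'_sep.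
have := kappa_le_grid_j d0 k1 c0 delta0; rewrite -/n.
set K := (kappa R d)%:~R => K_le A'_lt.
have kd1 : (1 < k ^ d)%N by rewrite -(exp1n d) ltn_exp2r.
have step0 : 0 < (((k ^ d - 1) * s ^ d) ^ n)%N%:R :> R.
  by rewrite ltr0n expn_gt0 muln_gt0 subn_gt0 kd1 expn_gt0 ltnW.
have H : c * L ^+ d < (((k ^ d - 1) * s ^ d) ^ n)%N%:R * (K * (L / (k * s)%N%:R ^+ n / delta) ^+ d).
  by apply: le_lt_trans (le_trans A_card leA) _; rewrite natrM ltr_pM2l.
(* Cancelling the powers of [L] and [s] in [H] leaves [r ^+ n * (c * delta ^+ d) < K], with [r] the
   ratio [grid_r R d k], against [K_le]. *)
move: K_le; rewrite ler_pdivrMr ?mulr_gt0 ?exprn_gt0 //; apply/negP; rewrite -ltNge.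
pose a := (k ^ d)%N%:R : R; have a1 : 1 < a by rewrite ltr1n.
have sd0 : 0 < (s%:R ^+ d) ^+ n :> R by rewrite !exprn_gt0 ?ltr0n ?(ltnW s1).
rewrite /grid_r -/a expr_div_n mulrAC ltr_pdivrMr ?exprn_gt0 ?subr_gt0 //.
rewrite -(ltr_pM2r sd0) -(ltr_pM2r (exprn_gt0 d L0)).
have EL : L / (k * s)%N%:R ^+ n / delta = L / (((k * s)%N%:R ^+ n) * delta) by rewrite invfM mulrA.
move: H; rewrite EL expr_div_n !mulrA ltr_pdivlMr; last by rewrite exprn_gt0 ?mulr_gt0 ?exprn_gt0.
have -> : (((k ^ d - 1) * s ^ d) ^ n)%N%:R = ((a - 1) * s%:R ^+ d) ^+ n :> R.
  by rewrite natrX natrM natrB ?(ltnW kd1) // (natrX R s).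
have -> : ((k * s)%N%:R ^+ n * delta) ^+ d = (a * s%:R ^+ d) ^+ n * delta ^+ d.
  by rewrite exprMn exprAC natrM exprMn -(natrX R k).
rewrite !exprMn.
clear; move: (L ^+ d) (delta ^+ d) ((a - 1) ^+ n) (a ^+ n) ((s%:R ^+ d) ^+ n) K.
move=> l D b B t K0 H.
rewrite (_ : B * c * D * t * l = c * l * (B * t * D)); last by ring.
by rewrite (_ : K0 * b * t * l = b * t * K0 * l) //; ring.
Qed.

End Threshold.

Theorem theorem7 (R : realType) (d k : nat) (c delta eps : R)
  (hd : (0 < d)%N) (hk : (0 < k)%N) (hc : 0 < c) (hdelta : 0 < delta)
  (heps0 : 0 < eps) (heps : eps <= 1 / 3) :
  (exists Z0 : R, 0 < Z0 /\ grid_threshold d k c delta eps Z0) /\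
  (0 < Z0_explicit d k c delta eps /\
   grid_threshold d k c delta eps (Z0_explicit d k c delta eps)).
Proof.
have H := grid_threshold_explicit hd hk hc hdelta heps0 heps.
by split; first by exists (Z0_explicit d k c delta eps).
Qed.
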